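(* Let $G=\mathrm{GL}(n,\mathbb{R})$ be equipped with the left invariant Riemannian metric determined by the Frobenius inner product $\langle X,Y\rangle=\mathrm{tr}(X^\top Y)$ on $\mathfrak{g}=\mathfrak{gl}(n,\mathbb{R})$, and let $R$ be its curvature tensor. Let $u,v\in\mathfrak{g}$ and let $u_1=(u+u^\top)/2$, $v_1=(v+v^\top)/2$ be their symmetric parts. If $[u,v]=0$, then $$\langle R(u,v)v,u\rangle=-4\|[u_1,v_1]\|^2\le0.$$
   Context: The Lie algebra $\mathfrak{g}=\mathfrak{gl}(n,\mathbb{R})$ is the space of $n\times n$ real matrices with bracket $[u,v]=uv-vu$; $\|u\|=\langle u,u\rangle^{1/2}$. An element $u\in\mathfrak{g}$ is also identified with the left invariant vector field on $G$ whose value at the identity is $u$. $\nabla$ is the Levi-Civita connection; for left invariant fields it is given by $\langle\nabla_uv,w\rangle=\frac12(\langle[u,v],w\rangle-\langle[v,w],u\rangle-\langle[u,w],v\rangle)$, equivalently $\nabla_uv=\frac12([u,v]+[u,v^\top]+[v,u^\top])$. The curvature tensor is $R(u,v)w=\nabla_u(\nabla_vw)-\nabla_v(\nabla_uw)-\nabla_{[u,v]}w$. *)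

(* Defs.v *)
From HB Require Import structures.
From mathcomp Require Import all_boot all_order all_algebra.
From mathcomp Require Import all_classical all_reals all_analysis.

Set Implicit Arguments.
Unset Strict Implicit.
Unset Printing Implicit Defensive.

Import Order.TTheory GRing.Theory Num.Theory.
Import numFieldNormedType.Exports.

Local Open Scope classical_set_scope.
Local Open Scope ring_scope.

(* GL(n, R) is treated as the open subset [unitmx] of the normed space of
   n x n matrices, which gives it a global chart and identifies every tangent
   space with 'M[R]_n.  A vector field (resp. a function) on GL(n, R) is
   represented by a total map 'M[R]_n -> 'M[R]_n (resp. 'M[R]_n -> R) of which
   only the values at invertible matrices are meaningful: all conditions and
   equations below are required at points of GL(n, R) only. *)

Section LieAlgebra.
Context {R : realType} {n : nat}.
Implicit Types u v : 'M[R]_n.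

Definition mxbracket u v : 'M[R]_n := u *m v - v *m u.

Definition frob u v : R := \tr (u^T *m v).

Definition frob_norm u : R := Num.sqrt (frob u u).

Definition sympart u : 'M[R]_n := 2^-1 *: (u + u^T).

End LieAlgebra.

Section VectorFields.
Context {R : realType} {n : nat}.

Definition vfield := 'M[R]_n -> 'M[R]_n.

Definition eq_on_GL {V : Type} (f g : 'M[R]_n -> V) : Prop :=
  forall x, x \in unitmx -> f x = g x.

(* f is C^k on GL(n, R): f is continuous there and, when k > 0, all its
   directional derivatives (along constant directions) exist there and are
   C^(k-1).  The value of 'D_h f at a point of the open set GL(n, R) depends
   only on the values of f on GL(n, R). *)
Fixpoint Ck_on_GL {V : normedModType R} (k : nat) (f : 'M[R]_n -> V) : Prop :=
  (forall x, x \in unitmx -> {for x, continuous f}) /\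
  (if k is k'.+1 then
     forall h : 'M[R]_n,
       (forall x, x \in unitmx -> derivable f x h) /\
       Ck_on_GL k' (fun x => 'D_h f x)
   else True).

Definition smooth_on_GL {V : normedModType R} (f : 'M[R]_n -> V) : Prop :=
  forall k, Ck_on_GL k f.

(* [X, Y] in the global chart; it satisfies [X, Y] f = X (Y f) - Y (X f). *)
Definition vbracket (X Y : vfield) : vfield :=
  fun x => 'D_(X x) Y x - 'D_(Y x) X x.

(* The differential at 1 of the left translation by x is u |-> x *m u. *)
Definition left_field (u : 'M[R]_n) : vfield := fun x => x *m u.

(* The left invariant metric on GL(n, R) equal to [frob] at the identity. *)
Definition left_metric (x a b : 'M[R]_n) : R :=
  frob (invmx x *m a) (invmx x *m b).

Definition connection := vfield -> vfield -> vfield.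

(* [conn_ext] says that the connection acts on vector fields on GL(n, R),
   that is, on total maps up to equality on GL(n, R). *)
Record affine_connection (nabla : connection) : Prop := AffineConnection {
  conn_smooth : forall X Y : vfield, smooth_on_GL X -> smooth_on_GL Y ->
    smooth_on_GL (nabla X Y);
  conn_ext : forall X X' Y Y' : vfield,
    smooth_on_GL X -> smooth_on_GL X' -> smooth_on_GL Y -> smooth_on_GL Y' ->
    eq_on_GL X X' -> eq_on_GL Y Y' -> eq_on_GL (nabla X Y) (nabla X' Y');
  conn_addl : forall X X' Y : vfield,
    smooth_on_GL X -> smooth_on_GL X' -> smooth_on_GL Y ->
    eq_on_GL (nabla (fun x => X x + X' x) Y)
             (fun x => nabla X Y x + nabla X' Y x);
  conn_scalel : forall (f : 'M[R]_n -> R) (X Y : vfield),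
    smooth_on_GL f -> smooth_on_GL X -> smooth_on_GL Y ->
    eq_on_GL (nabla (fun x => f x *: X x) Y) (fun x => f x *: nabla X Y x);
  conn_addr : forall X Y Y' : vfield,
    smooth_on_GL X -> smooth_on_GL Y -> smooth_on_GL Y' ->
    eq_on_GL (nabla X (fun x => Y x + Y' x))
             (fun x => nabla X Y x + nabla X Y' x);
  conn_leibniz : forall (f : 'M[R]_n -> R) (X Y : vfield),
    smooth_on_GL f -> smooth_on_GL X -> smooth_on_GL Y ->
    eq_on_GL (nabla X (fun x => f x *: Y x))
             (fun x => 'D_(X x) f x *: Y x + f x *: nabla X Y x)
}.

(* Torsion-free and compatible with the metric g. *)
Record levi_civita (g : 'M[R]_n -> 'M[R]_n -> 'M[R]_n -> R)
    (nabla : connection) : Prop := LeviCivita {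
  lc_connection : affine_connection nabla;
  lc_torsion_free : forall X Y : vfield, smooth_on_GL X -> smooth_on_GL Y ->
    eq_on_GL (fun x => nabla X Y x - nabla Y X x) (vbracket X Y);
  lc_metric : forall X Y Z : vfield,
    smooth_on_GL X -> smooth_on_GL Y -> smooth_on_GL Z ->
    eq_on_GL (fun x => 'D_(X x) (fun y => g y (Y y) (Z y)) x)
             (fun x => g x (nabla X Y x) (Z x) + g x (Y x) (nabla X Z x))
}.

Definition curvature (nabla : connection) (X Y Z : vfield) : vfield :=
  fun x => nabla X (nabla Y Z) x - nabla Y (nabla X Z) x
           - nabla (vbracket X Y) Z x.

End VectorFields.

Arguments vfield R n : clear implicits.
Arguments connection R n : clear implicits.

(* Main.v *)
Require Import Defs.
From HB Require Import structures.
From mathcomp Require Import all_boot all_order all_algebra.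
From mathcomp Require Import all_classical all_reals all_analysis.
From mathcomp Require Import perm ring lra.

(** On left invariant fields the Koszul formula forces any Levi-Civita connection
    to be [u, v |-> left_nabla u v], and since each [left_nabla u] is
    skew-adjoint, [[u, v] = 0] gives
    [<R(u,v)v,u> = |nabla_u v|^2 - <nabla_u u, nabla_v v>].
    Write [u = a + b], [v = c + d] with [a], [c] symmetric and [b], [d] skew.
    The skew and symmetric parts of [[u, v] = 0] are [[a,c] = - [b,d]] and
    [[b,c] = - [a,d]], so that [nabla_u v = - 2 [a,d]], [nabla_u u = - 2 [a,b]],
    [nabla_v v = - 2 [c,d]], and the claim becomes the trace form of the Jacobi
    identity,
    [tr([a,b][c,d]) + tr([b,c][a,d]) + tr([c,a][b,d]) = 0]. *)

Import Order.TTheory GRing.Theory Num.Theory.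
Import numFieldNormedType.Exports.

Local Open Scope ring_scope.

(** * Entrywise continuity and openness of GL(n, R) *)

Section MatrixTopology.
Local Open Scope classical_set_scope.

(** A neighbourhood of a matrix contains a box of entrywise neighbourhoods, and finitely many
    entries give a finite intersection. *)
Lemma continuous_mx (K T : topologicalType) (m n : nat) (f : T -> 'M[K]_(m, n)) :
  (forall i j, continuous (fun x => f x i j)) -> continuous f.
Proof.
move=> fC x A [P fxP PA].
have /filterS : forall y, (forall i j, P i j (f y i j)) -> A (f y).
  by move=> y ?; apply: PA.
apply; apply: filter_forall => i; apply: filter_forall => j.
exact: fC (fxP i j).
Qed.

Lemma mulmxr_continuous (R : realType) (m n p : nat) (u : 'M[R]_(n, p)) :
  continuous (mulmxr u : 'M[R]_(m, n) -> 'M[R]_(m, p)).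
Proof.
apply: (@continuous_mx R) => i j /=.
under eq_fun do rewrite mxE.
apply: continuous_big => [|k _ x]; first exact: add_continuous.
by apply: continuousM; [exact: coord_continuous | exact: cst_continuous].
Qed.

Lemma det_continuous (R : realType) (n : nat) :
  continuous (fun A : 'M[R]_n => \det A).
Proof.
apply: continuous_big => [|s _ A]; first exact: add_continuous.
have prodC : continuous (fun B : 'M[R]_n => \prod_i B i (s i)).
  apply: continuous_big => [|i _]; first exact: mul_continuous.
  exact: coord_continuous.
exact: (continuousM (@cst_continuous _ _ ((-1) ^+ s : R) A) (prodC A)).
Qed.

Lemma near_unitmx (R : realType) (n : nat) (x : 'M[R]_n) :
  x \in unitmx -> \forall y \near x, y \in unitmx.
Proof.
rewrite unitmxE unitfE => dx0.
near=> y; rewrite unitmxE unitfE; near: y.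
apply: cvgr_neq0 dx0; exact: det_continuous.
Unshelve. all: by end_near. Qed.

End MatrixTopology.

(** * Calculus of left invariant fields *)

Section LeftFields.
Context {R : realType} {n : nat}.
Implicit Types u v w x h : 'M[R]_n.

Lemma differentiable_left_field u x : differentiable (left_field u) x.
Proof.
exact: (@linear_differentiable R _ _ (mulmxr u) x (mulmxr_continuous R n n n u)).
Qed.

Lemma derive_left_field u x h : 'D_h (left_field u) x = h *m u.
Proof.
rewrite deriveE; last exact: differentiable_left_field.
by rewrite (@diff_lin R _ _ (mulmxr u) x (mulmxr_continuous R n n n u)).
Qed.

Lemma smooth_cst (V : normedModType R) (c : V) :
  smooth_on_GL (fun _ : 'M[R]_n => c).
Proof.
move=> k; elim: k V c => [|k IHk] V c /=.
  by split=> // x _; exact: cst_continuous.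
split=> [x _|h]; first exact: cst_continuous.
split=> [x _|]; first exact: derivable_cst.
by under eq_fun do rewrite derive_cst; exact: IHk.
Qed.

Lemma left_field_continuous u x : {for x, continuous (left_field u)}.
Proof. exact: differentiable_continuous (differentiable_left_field u x). Qed.

(** The field is linear in the point, so its derivative along [h] is the constant [h *m u]. *)
Lemma smooth_left_field u : smooth_on_GL (left_field u).
Proof.
case=> [|k] /=; split.
- by move=> x _; exact: left_field_continuous.
- exact: I.
- by move=> x _; exact: left_field_continuous.
move=> h; split=> [x _|].
  by apply: diff_derivable; exact: differentiable_left_field.
by under eq_fun do rewrite derive_left_field; exact: smooth_cst.
Qed.

Lemma vbracket_left_field u v :
  vbracket (left_field u) (left_field v) = left_field (mxbracket u v).
Proof.
apply/funext => x; rewrite /vbracket !derive_left_field /left_field.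
by rewrite /mxbracket mulmxBr !mulmxA.
Qed.

Lemma left_metric_mull x u v : x \in unitmx ->
  left_metric x (x *m u) (x *m v) = frob u v.
Proof. by move=> xu; rewrite /left_metric !mulKmx. Qed.

(** The function equals [frob v w] only where [invmx] is a true inverse; openness of GL(n, R) makes
    this hold near [x], which suffices for the derivative. *)
Lemma derive_left_metric_left_field x h v w : x \in unitmx ->
  'D_h (fun y => left_metric y (left_field v y) (left_field w y)) x = 0.
Proof.
move=> xu; rewrite -(derive_cst (V := 'M[R]_n) (frob v w) x h).
apply: near_eq_derive; near=> y.
by apply: left_metric_mull; near: y; exact: near_unitmx.
Unshelve. all: by end_near. Qed.

End LeftFields.

(** * Frobenius inner product and traces of brackets *)

Section Frobenius.
Context {R : realType} {n : nat}.
Implicit Types u v w : 'M[R]_n.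

Lemma frobE u v : frob u v = \sum_i \sum_j u j i * v j i.
Proof.
apply: eq_bigr => i _; rewrite mxE; apply: eq_bigr => j _.
by rewrite mxE.
Qed.

Lemma frobC u v : frob u v = frob v u.
Proof. by rewrite /frob -mxtrace_tr trmx_mul trmxK. Qed.

Lemma frobDl u v w : frob (u + v) w = frob u w + frob v w.
Proof. by rewrite /frob linearD mulmxDl linearD. Qed.

Lemma frobNl u w : frob (- u) w = - frob u w.
Proof. by rewrite /frob linearN mulNmx linearN. Qed.

Lemma frobZl a u w : frob (a *: u) w = a * frob u w.
Proof. by rewrite /frob linearZ -scalemxAl linearZ. Qed.

Lemma frob0l w : frob 0 w = 0.
Proof. by rewrite -(scale0r 0) frobZl mul0r. Qed.

Lemma frob_ge0 u : 0 <= frob u u.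
Proof.
rewrite frobE; apply: sumr_ge0 => i _; apply: sumr_ge0 => j _.
by rewrite -expr2 sqr_ge0.
Qed.

Lemma frob_eq0 u : frob u u = 0 -> u = 0.
Proof.
rewrite frobE => /eqP; rewrite psumr_eq0 => [/allP u0|i _]; last first.
  by apply: sumr_ge0 => j _; rewrite -expr2 sqr_ge0.
apply/matrixP => j i; rewrite mxE.
have := u0 i (mem_index_enum i); rewrite /= psumr_eq0 => [/allP ui0|k _].
  by have := ui0 j (mem_index_enum j); rewrite /= -expr2 sqrf_eq0 => /eqP.
by rewrite -expr2 sqr_ge0.
Qed.

Lemma frob_inj u v : (forall w, frob u w = frob v w) -> u = v.
Proof.
move=> uv; apply/eqP; rewrite -subr_eq0; apply/eqP/frob_eq0.
by rewrite frobDl frobNl uv subrr.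
Qed.

Lemma frob_norm_sqr u : frob_norm u ^+ 2 = frob u u.
Proof. by rewrite /frob_norm sqr_sqrtr ?frob_ge0. Qed.

Lemma mxtraceB u v : \tr (u - v) = \tr u - \tr v.
Proof. exact: linearB. Qed.

Lemma mxtraceN u : \tr (- u) = - \tr u.
Proof. exact: linearN. Qed.

Lemma trmxB u v : (u - v)^T = u^T - v^T.
Proof. exact: linearB. Qed.

Lemma trmxD u v : (u + v)^T = u^T + v^T.
Proof. exact: linearD. Qed.

Lemma trmxN u : (- u)^T = - u^T.
Proof. exact: linearN. Qed.

Lemma mxbracketC u v : mxbracket u v = - mxbracket v u.
Proof. by rewrite /mxbracket opprB. Qed.

(** The adjoint of [ad v] is [ad v^T], by cyclicity of the trace. *)
Lemma frob_bracketl u v w : frob (mxbracket v w) u = frob (mxbracket v^T u) w.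
Proof.
rewrite [RHS]frobC /frob /mxbracket trmxB !trmx_mul mulmxBl mulmxBr.
rewrite !mxtraceB !mulmxA; congr (_ - _).
by rewrite -[in LHS]mulmxA [LHS]mxtrace_mulC.
Qed.

(** By invariance of the trace form, [tr([a,b][c,d]) = tr([[a,b],c]d)], so this is the Jacobi
    identity for [a], [b], [c] paired with [d]. Concretely, rotating [d] to the end of each monomial
    makes the twelve traces cancel in pairs. *)
Lemma mxtrace_bracket_jacobi (a b c d : 'M[R]_n) :
  \tr (mxbracket a b *m mxbracket c d) + \tr (mxbracket b c *m mxbracket a d)
  + \tr (mxbracket c a *m mxbracket b d) = 0.
Proof.
rewrite /mxbracket !(mulmxBl, mulmxBr) !mxtraceB !mulmxA.
have tr_d (p q r : 'M[R]_n) : \tr (p *m q *m d *m r) = \tr (r *m p *m q *m d).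
  by rewrite mxtrace_mulC !mulmxA.
rewrite !tr_d.
ring.
Qed.

End Frobenius.

(** * Connection and curvature on left invariant fields *)

Section LeftInvariantConnection.
Context {R : realType} {n : nat}.
Implicit Types u v w x : 'M[R]_n.

(** The Koszul formula solved for the connection; the transposes come from the adjoints of [ad u]
    and [ad v]. *)
Definition left_nabla u v : 'M[R]_n :=
  2^-1 *: (mxbracket u v + mxbracket u v^T + mxbracket v u^T).

Lemma frob_left_nabla u v w :
  2 * frob (left_nabla u v) w
  = frob (mxbracket u v) w - frob (mxbracket v w) u - frob (mxbracket u w) v.
Proof.
rewrite /left_nabla frobZl 2!frobDl mulrA divff ?mul1r ?pnatr_eq0 //.
by rewrite (mxbracketC u v^T) (mxbracketC v u^T) !frobNl -!frob_bracketl.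
Qed.

(** Exchanging [v] and [w] negates the right side of the Koszul formula. *)
Lemma left_nabla_metric u v w :
  frob (left_nabla u v) w = - frob v (left_nabla u w).
Proof.
rewrite [frob v _]frobC.
have := frob_left_nabla u v w; have := frob_left_nabla u w v.
rewrite (mxbracketC w v) frobNl; lra.
Qed.

(** The usual uniqueness argument: the three cyclic instances of metric compatibility, combined with
    torsion, determine [frob (A u v) w] for every [w]. *)
Lemma koszul (A : 'M[R]_n -> 'M[R]_n -> 'M[R]_n) :
  (forall u v, A u v - A v u = mxbracket u v) ->
  (forall u v w, frob (A u v) w + frob v (A u w) = 0) ->
  forall u v, A u v = left_nabla u v.
Proof.
move=> torsion metric u v; apply: frob_inj => w.
have T p q r : frob (A p q) r - frob (A q p) r = frob (mxbracket p q) r.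
  by rewrite -torsion frobDl frobNl.
have M p q r : frob (A p q) r + frob (A p r) q = 0.
  by rewrite -[RHS](metric p q r) [frob q _]frobC.
have := frob_left_nabla u v w; rewrite -!T.
move: (M u v w) (M v w u) (M w u v).
lra.
Qed.

Lemma levi_civita_left_field (nabla : connection R n) u v :
  levi_civita left_metric nabla ->
  eq_on_GL (nabla (left_field u) (left_field v))
           (left_field (left_nabla u v)).
Proof.
move=> [_ torsion metric] x xu.
have sl := @smooth_left_field R n.
(* The connection at [x], translated back to the identity. A priori [A] depends on [x]; [koszul]
   shows that it does not, so left invariance of [nabla] on these fields is a conclusion. *)
pose A p q := invmx x *m nabla (left_field p) (left_field q) x.
have nablaA p q : nabla (left_field p) (left_field q) x = x *m A p q.
  by rewrite /A mulKVmx.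
rewrite nablaA /left_field; congr (_ *m _); apply: koszul => [p q|p q r].
  have := torsion _ _ (sl p) (sl q) x xu.
  by rewrite vbracket_left_field /A -mulmxBr => ->; rewrite mulKmx.
have := metric _ _ _ (sl p) (sl q) (sl r) x xu.
by rewrite derive_left_metric_left_field // !nablaA !left_metric_mull.
Qed.

Lemma curvature_left_field (nabla : connection R n) u v w :
  levi_civita left_metric nabla ->
  eq_on_GL (curvature nabla (left_field u) (left_field v) (left_field w))
    (left_field (left_nabla u (left_nabla v w) - left_nabla v (left_nabla u w)
                 - left_nabla (mxbracket u v) w)).
Proof.
move=> Hnabla x xu; have sl := @smooth_left_field R n.
have [Hconn _ _] := Hnabla.
have nabla2 p q : nabla (left_field p) (nabla (left_field q) (left_field w)) x
    = left_field (left_nabla p (left_nabla q w)) x.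
  rewrite -(levi_civita_left_field _ _ _ Hnabla x xu).
  (* The inner derivative agrees with a left invariant field on GL(n, R) only, hence the passage
     through [conn_ext]. *)
  apply: (conn_ext Hconn) => //; first exact: conn_smooth.
  exact: levi_civita_left_field.
rewrite /curvature !nabla2 vbracket_left_field.
by rewrite (levi_civita_left_field _ _ _ Hnabla x xu) /left_field !mulmxBr.
Qed.

(** In [[u, v^T] + [v, u^T]] the symmetric-symmetric and skew-skew brackets cancel, while the mixed
    ones double. *)
Lemma left_nabla_cartan a b c d :
  a^T = a -> b^T = - b -> c^T = c -> d^T = - d ->
  left_nabla (a + b) (c + d)
  = 2^-1 *: mxbracket (a + b) (c + d) + mxbracket b c - mxbracket a d.
Proof.
move=> Ea Eb Ec Ed; rewrite /left_nabla !trmxD Ea Eb Ec Ed /mxbracket.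
rewrite !(mulmxDl, mulmxDr, mulmxN, mulNmx).
move: (a *m c) (a *m d) (b *m c) (b *m d) (c *m a) (c *m b) (d *m a) (d *m b).
by move=> p q r s t y z o; apply/matrixP => i j; rewrite !mxE; field.
Qed.

Lemma sectional_cartan a b c d :
  a^T = a -> b^T = - b -> c^T = c -> d^T = - d ->
  mxbracket (a + b) (c + d) = 0 ->
  frob (left_nabla (a + b) (c + d)) (left_nabla (a + b) (c + d))
  - frob (left_nabla (a + b) (a + b)) (left_nabla (c + d) (c + d))
  = - 4 * frob (mxbracket a c) (mxbracket a c).
Proof.
move=> Ea Eb Ec Ed Euv.
have bracketT p q : (mxbracket p q)^T = - mxbracket p^T q^T :> 'M[R]_n.
  by rewrite /mxbracket trmxB !trmx_mul opprB.
have bracketN p q : mxbracket p (- q) = - mxbracket p q :> 'M[R]_n.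
  by rewrite /mxbracket mulmxN mulNmx opprB opprK addrC.
have NbracketN p q : mxbracket (- p) q = - mxbracket p q :> 'M[R]_n.
  by rewrite /mxbracket mulmxN mulNmx opprB opprK addrC.
have Exx p : mxbracket p p = 0 :> 'M[R]_n by rewrite /mxbracket subrr.
have Esplit : mxbracket (a + b) (c + d) = (mxbracket a c + mxbracket b d)
    + (mxbracket a d + mxbracket b c).
  rewrite /mxbracket !(mulmxDl, mulmxDr).
  move: (a *m c) (a *m d) (b *m c) (b *m d) (c *m a) (c *m b) (d *m a) (d *m b).
  by move=> p q r s t y z o; apply/matrixP => i j; rewrite !mxE; ring.
have Esum : mxbracket a c + mxbracket b d + (mxbracket a d + mxbracket b c) = 0.
  by rewrite -Esplit.
(* Transposing [Esum] negates the skew brackets [[a,c]], [[b,d]] and fixes the symmetric ones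
   [[a,d]], [[b,c]]; with [Esum] this separates the two parts. *)
have Edif : - (mxbracket a c + mxbracket b d) + (mxbracket a d + mxbracket b c) = 0.
  move/(congr1 trmx): Esum.
  rewrite trmxD (trmxD (mxbracket a c)) (trmxD (mxbracket a d)) !bracketT Ea Eb Ec Ed.
  by rewrite !(bracketN, NbracketN) !opprK trmx0 => <-; rewrite opprD.
have Eac : mxbracket b d = - mxbracket a c.
  move: Esum Edif.
  move: (mxbracket a c) (mxbracket b d) (mxbracket a d) (mxbracket b c).
  move=> p q r s Esum Edif; apply/matrixP => i j.
  move/matrixP/(_ i j): Esum; move/matrixP/(_ i j): Edif.
  by rewrite !mxE; lra.
have Ebc : mxbracket b c = - mxbracket a d.
  move: Esum Edif.
  move: (mxbracket a c) (mxbracket b d) (mxbracket a d) (mxbracket b c).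
  move=> p q r s Esum Edif; apply/matrixP => i j.
  move/matrixP/(_ i j): Esum; move/matrixP/(_ i j): Edif.
  by rewrite !mxE; lra.
have Tad : (mxbracket a d)^T = mxbracket a d.
  by rewrite bracketT Ea Ed bracketN opprK.
have Tba : (mxbracket b a)^T = mxbracket b a.
  by rewrite bracketT Ea Eb NbracketN opprK.
have Tac : (mxbracket a c)^T = - mxbracket a c by rewrite bracketT Ea Ec.
(* This and the next two facts express each term through one summand of [mxtrace_bracket_jacobi];
   symmetry or skewness of the brackets removes the transpose in [frob]. *)
have nabla_uv : frob (left_nabla (a + b) (c + d)) (left_nabla (a + b) (c + d))
    = - 4 * \tr (mxbracket b c *m mxbracket a d).
  rewrite left_nabla_cartan // Euv scaler0 add0r Ebc /frob trmxB trmxN.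
  rewrite Tad; move: (mxbracket a d) => p.
  rewrite !(mulmxBl, mulmxBr, mulNmx, mulmxN) !(mxtraceB, mxtraceN).
  ring.
have nabla_uu_vv :
    frob (left_nabla (a + b) (a + b)) (left_nabla (c + d) (c + d))
    = 4 * \tr (mxbracket a b *m mxbracket c d).
  rewrite !left_nabla_cartan // !Exx !scaler0 !add0r.
  rewrite (mxbracketC a b) (mxbracketC c d) !opprK /frob trmxD Tba.
  move: (mxbracket b a) (mxbracket d c) => p q.
  rewrite !(mulmxDl, mulmxDr, mulNmx, mulmxN) !(mxtraceD, mxtraceN).
  ring.
have norm_ac : frob (mxbracket a c) (mxbracket a c)
    = - \tr (mxbracket c a *m mxbracket b d).
  rewrite Eac (mxbracketC c a) /frob Tac !(mulNmx, mulmxN) !mxtraceN.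
  ring.
rewrite nabla_uv nabla_uu_vv norm_ac.
have := mxtrace_bracket_jacobi a b c d; lra.
Qed.

End LeftInvariantConnection.

Theorem theorem3p1 (R : realType) (n : nat) (nabla : connection R n)
    (Hnabla : levi_civita left_metric nabla) (u v : 'M[R]_n)
    (Huv : mxbracket u v = 0) :
  forall x : 'M[R]_n, x \in unitmx ->
    left_metric x
      (curvature nabla (left_field u) (left_field v) (left_field v) x)
      (left_field u x)
      = - 4 * frob_norm (mxbracket (sympart u) (sympart v)) ^+ 2
    /\ - 4 * frob_norm (mxbracket (sympart u) (sympart v)) ^+ 2 <= 0.
Proof.
move=> x xu; rewrite frob_norm_sqr; split; last first.
  by rewrite mulNr oppr_le0 mulr_ge0 ?frob_ge0.
rewrite curvature_left_field // left_metric_mull // Huv 2!frobDl 2!frobNl.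
have symT (w : 'M[R]_n) : (sympart w)^T = sympart w.
  by rewrite /sympart linearZ /= trmxD trmxK addrC.
have skewT (w : 'M[R]_n) : (w - sympart w)^T = - (w - sympart w).
  rewrite trmxB symT /sympart.
  by apply/matrixP => i j; rewrite !mxE; field.
have splitE (w : 'M[R]_n) : sympart w + (w - sympart w) = w.
  by rewrite addrC subrK.
have nabla0 : left_nabla 0 v = 0.
  by rewrite /left_nabla /mxbracket trmx0 !(mul0mx, mulmx0) !subrr !addr0 scaler0.
(* Torsion-freeness for commuting [u] and [v]. *)
have nablaC : left_nabla v u = left_nabla u v.
  rewrite /left_nabla Huv (mxbracketC v u) Huv oppr0 !add0r.
  by rewrite [X in _ *: X]addrC.
have := sectional_cartan (sympart u) (u - sympart u) (sympart v)
  (v - sympart v) (symT u) (skewT u) (symT v) (skewT v).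
rewrite !splitE => /(_ Huv) <-.
(* Skew-adjointness moves each outer derivative onto [u], leaving the two inner products of
   [sectional_cartan]. *)
rewrite (left_nabla_metric u (left_nabla v v)) nabla0.
rewrite (left_nabla_metric v (left_nabla u v)) nablaC frob0l.
rewrite [frob (left_nabla v v) _]frobC.
ring.
Qed.
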